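(* Let $A,B,N_1,\dots,N_m,M_1,\dots,M_m\in\mathbb{R}^{n\times n}$ and $C_1,C_2\in\mathbb{R}^{n\times r}$, with $A$ and $B$ nonsingular, and consider the generalized Sylvester equation $AX+XB^T+\sum_{i=1}^mN_iXM_i^T=C_1C_2^T$. Assume that $[A,N_i]=U_i\tilde U_i^T$ and $[B,M_i]=Q_i\tilde Q_i^T$ with $U_i,\tilde U_i\in\mathbb{R}^{n\times s_i}$ and $Q_i,\tilde Q_i\in\mathbb{R}^{n\times t_i}$, $i=1,\dots,m$. Let $d$ be the maximum number of iterations of the extended Krylov subspace method for Sylvester equations (described in the context). Let $\tilde Y_0=L_0R_0^T$ be the result of this method applied to the Sylvester equation $$AY+YB^T=C_1C_2^T$$ with starting blocks $\bar C_1=C_1$ and $\bar C_2=C_2$. For $j=0,\dots,\ell-1$, let $\tilde Y_{j+1}=L_{j+1}R_{j+1}^T$ be the result of this method applied to the Sylvester equation $$AY+YB^T=-\sum_{i=1}^m(N_iL_j)(M_iR_j)^T$$ with starting blocks $\bar C_1=(N_1L_j,\dots,N_mL_j)$ and $\bar C_2=(M_1R_j,\dots,M_mR_j)$. Let $\tilde X^{(\ell)}:=\sum_{j=0}^{\ell}\tilde Y_j$. Then there exist matrices $L,R,\hat C_1^{(\ell)},\hat C_2^{(\ell)}$ such that $$\tilde X^{(\ell)}=LR^T,\qquad \operatorname{range}(L)\subseteq\mathbf{EK}^{\square}_{(\ell+1)d}(A,\hat C_1^{(\ell)}),\qquad \operatorname{range}(R)\subseteq\mathbf{EK}^{\square}_{(\ell+1)d}(B,\hat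 C_2^{(\ell)}),$$ where $$\operatorname{range}(\hat C_1^{(\ell)})\subseteq\mathbf{G}_{\ell}(N_1,\dots,N_m;C_1)+\mathbf{G}_{\ell-1}(N_1,\dots,N_m;U),$$ $$\operatorname{range}(\hat C_2^{(\ell)})\subseteq\mathbf{G}_{\ell}(M_1,\dots,M_m;C_2)+\mathbf{G}_{\ell-1}(M_1,\dots,M_m;Q),$$ and $U:=(U_1,\dots,U_m)$, $Q:=(Q_1,\dots,Q_m)$.
   Context: Notation. $[A,B]:=AB-BA$. $\operatorname{range}(M)$ is the space generated by the columns of $M$. $(A_1,\dots,A_p)$ denotes the matrix obtained by placing $A_1,\dots,A_p$ next to each other. Extended block Krylov subspaces. For $A\in\mathbb{R}^{n\times n}$, $C\in\mathbb{R}^{n\times r}$, $\mathbf{K}_k^{\square}(A,C):=\operatorname{span}\{p(A)Cw : p\in\mathbb{R}[x],\deg(p)\le k,w\in\mathbb{R}^r\}$, and for invertible $A$, $\mathbf{EK}_k^{\square}(A,C):=\mathbf{K}_k^{\square}(A,C)+\mathbf{K}_k^{\square}(A^{-1},A^{-1}C)$. Multivariate Krylov subspaces. For $U\in\mathbb{R}^{n\times r}$, $\mathbf{G}_d(N_1,\dots,N_m;U):=\operatorname{span}\{p(N_1,\dots,N_m)Uz : \deg(p)\le d,\ z\in\mathbb{R}^r\}$, where $p$ ranges over non-commutative polynomials in the free algebra $\mathbb{R}\langle x_1,\dots,x_m\rangle$ (so $\mathbf{G}_{-1}=\{0\}$). Truncated Neumann series. With $\mathcal{L}(X)=AX+XB^T$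 and $\Pi(X)=\sum_iN_iXM_i^T$, $\tilde X^{(\ell)}$ is meant as an approximation of $X^{(\ell)}=\sum_{j=0}^{\ell}Y_j$, $Y_0=\mathcal{L}^{-1}(C_1C_2^T)$, $Y_{j+1}=-\mathcal{L}^{-1}(\Pi(Y_j))$. Extended Krylov subspace method for a Sylvester equation $AY+YB^T=F_1F_2^T$ with starting blocks $\bar C_1,\bar C_2\in\mathbb{R}^{n\times\bar r}$, maximum number of iterations $d\ge1$ and a tolerance. Set $V_1=\operatorname{orth}(\bar C_1,A^{-1}\bar C_1)$, $W_1=\operatorname{orth}(\bar C_2,B^{-1}\bar C_2)$, where $\operatorname{orth}$ returns a matrix with orthonormal columns spanning the same space, and let $\mathcal{V}_0,\mathcal{W}_0$ be empty. For $k=1,2,\dots,d$: set $\mathcal{V}_k=(\mathcal{V}_{k-1},V_k)$, $\mathcal{W}_k=(\mathcal{W}_{k-1},W_k)$; solve the projected equation $(\mathcal{V}_k^TA\mathcal{V}_k)Z_k+Z_k(\mathcal{W}_k^TB\mathcal{W}_k)^T=\mathcal{V}_k^TF_1F_2^T\mathcal{W}_k$; stop if the residual norm $\|A X_k+X_kB^T-F_1F_2^T\|_F$, with $X_k=\mathcal{V}_kZ_k\mathcal{W}_k^T$, is at most the tolerance; otherwise let $V_k^{(1)},V_k^{(2)}$ be the first and last $\bar r$ columns of $V_k$ (likewise $W_k^{(1)},W_k^{(2)}$), form $(AV_k^{(1)},A^{-1}V_k^{(2)})$ and $(BW_k^{(1)},B^{-1}W_k^{(2)})$, orthogonalize them against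 $\mathcal{V}_k$ and $\mathcal{W}_k$ respectively, and let $V_{k+1},W_{k+1}$ be the results after $\operatorname{orth}$. Thus the columns of $\mathcal{V}_k$ form an orthonormal basis of the span of the columns of $A^j\bar C_1$, $-k\le j\le k-1$, and similarly for $\mathcal{W}_k$ with $B,\bar C_2$. At the final $k\le d$, factor $Z_k=\hat L\hat R^T$ and return the low-rank factors $L=\mathcal{V}_k\hat L$, $R=\mathcal{W}_k\hat R$, so that the computed approximation is $LR^T$. It is assumed that no breakdown occurs: the bases $\mathcal{V}_k,\mathcal{W}_k$ have full rank and the projected equations are solvable. *)

(* Defs.v *)
From mathcomp Require Import all_boot all_order all_algebra.
From mathcomp Require Import classical_sets reals.
From mathcomp Require Import monalg.

Set Implicit Arguments.
Unset Strict Implicit.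
Unset Printing Implicit Defensive.

Import Order.TTheory GRing.Theory Num.Theory.

Local Open Scope classical_set_scope.
Local Open Scope ring_scope.

Section Spans.
Variables (R : realType) (E : lmodType R).

Definition lspan (S : set E) : set E :=
  [set v | exists (k : nat) (c : 'I_k -> R) (x : 'I_k -> E),
     (forall i, S (x i)) /\ v = \sum_(i < k) c i *: x i].

Definition addspace (S T : set E) : set E := [set u + v | u in S & v in T].

End Spans.

Definition colspace (R : realType) (n p : nat) (M : 'M[R]_(n, p)) :
    set 'cV[R]_n :=
  lspan (range (fun j : 'I_p => col j M)).

Definition commutator (R : realType) (n : nat) (A B : 'M[R]_n) : 'M[R]_n :=
  A *m B - B *m A.

Definition frobenius (R : realType) (n p : nat) (M : 'M[R]_(n, p)) : R :=
  Num.sqrt (\sum_(i < n) \sum_(j < p) M i j ^+ 2).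

Section KrylovSpaces.
Variables (R : realType) (n r : nat).
Implicit Types (A : 'M[R]_n.+1) (C U : 'M[R]_(n.+1, r)).

(* size p is deg p + 1, and 0 when p = 0. *)
Definition krylov (k : nat) A C : set 'cV[R]_n.+1 :=
  lspan [set v | exists (p : {poly R}) (w : 'cV[R]_r),
           (size p <= k.+1)%N /\ v = horner_mx A p *m C *m w].

Definition ext_krylov (k : nat) A C : set 'cV[R]_n.+1 :=
  addspace (krylov k A C) (krylov k (invmx A) (invmx A *m C)).

(* The monoid algebra {malg R[{fmonom 'I_m}]} of the free monoid on 'I_m is the
   free algebra R<x_1, ..., x_m>; p(N_1, ..., N_m) evaluates a monomial, i.e.
   a word w : seq 'I_m, to the product of the N_i in the order of w. *)
Definition nc_eval (m : nat) (N : 'I_m -> 'M[R]_n.+1)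
    (p : {malg R[{fmonom 'I_m}]}) : 'M[R]_n.+1 :=
  mmap (fun c : R => c%:M) (fun w : {fmonom 'I_m} => \prod_(i <- w) N i) p.

(* mmeasure fdeg p is deg p + 1, and 0 when p = 0; the bound d is an integer so
   that d = -1 leaves only p = 0. *)
Definition mv_krylov (d : int) (m : nat) (N : 'I_m -> 'M[R]_n.+1) U :
    set 'cV[R]_n.+1 :=
  lspan [set v | exists (p : {malg R[{fmonom 'I_m}]}) (z : 'cV[R]_r),
           (mmeasure (@fdeg 'I_m) p)%:Z <= d + 1 /\ v = nc_eval N p *m U *m z].

End KrylovSpaces.

Section ExtendedKrylovMethod.
Variables (R : realType) (n r : nat).
Implicit Types (A B F : 'M[R]_n) (C : 'M[R]_(n, r)) (V W : nat -> 'M[R]_(n, r + r)).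

(* V is a possible output of orth(M): any orthonormal basis of the column space
   of M is allowed. *)
Definition is_orth (p q : nat) (M : 'M[R]_(n, p)) (V : 'M[R]_(n, q)) : Prop :=
  V^T *m V = 1%:M /\ colspace V = colspace M.

(* (V_1, ..., V_k); the value V 0 is never used. *)
Definition basis V (k : nat) : 'M[R]_(n, \sum_(j < k) (r + r)) :=
  \mxrow_(j < k) V j.+1.

(* All blocks have full width r + r, i.e. there is no breakdown. *)
Definition eks_start A C (V1 : 'M[R]_(n, r + r)) : Prop :=
  is_orth (row_mx C (invmx A *m C)) V1.

Definition eks_step A V (k : nat) : Prop :=
  let M := row_mx (A *m lsubmx (V k)) (invmx A *m rsubmx (V k)) in
  is_orth (M - basis V k *m ((basis V k)^T *m M)) (V k.+1).

Definition eks_approx V W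
    (Z : forall k, 'M[R]_(\sum_(j < k) (r + r), \sum_(j < k) (r + r)))
    (k : nat) : 'M[R]_n :=
  basis V k *m Z k *m (basis W k)^T.

Definition eks_residual A B F (X : 'M[R]_n) : R :=
  frobenius (A *m X + X *m B^T - F).

Definition eks_projected A B F V W
    (Z : forall k, 'M[R]_(\sum_(j < k) (r + r), \sum_(j < k) (r + r)))
    (k : nat) : Prop :=
  ((basis V k)^T *m A *m basis V k) *m Z k
    + Z k *m ((basis W k)^T *m B *m basis W k)^T
  = (basis V k)^T *m F *m basis W k.

(* The low-rank factors Lf, Rf are a possible result of the method applied to
   A Y + Y B^T = F with starting blocks C1, C2, at most d iterations and
   tolerance tol. K is the index of the last iteration. *)
Definition eks_result A B F C1 C2 (d : nat) (tol : R) (q : nat)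
    (Lf Rf : 'M[R]_(n, q)) : Prop :=
  exists (K : nat) V W
    (Z : forall k, 'M[R]_(\sum_(j < k) (r + r), \sum_(j < k) (r + r)))
    (Lh Rh : 'M[R]_(\sum_(j < K) (r + r), q)),
  (1 <= K <= d)%N /\
  eks_start A C1 (V 1) /\ eks_start B C2 (W 1) /\
  (forall k, (1 <= k <= K)%N -> eks_projected A B F V W Z k) /\
  (forall k, (1 <= k < K)%N ->
     [/\ tol < eks_residual A B F (eks_approx V W Z k),
         eks_step A V k & eks_step B W k]) /\
  (K = d \/ eks_residual A B F (eks_approx V W Z K) <= tol) /\
  Z K = Lh *m Rh^T /\
  Lf = basis V K *m Lh /\ Rf = basis W K *m Rh.

End ExtendedKrylovMethod.

(* Main.v *)
(** Fix [A] and write [E_a S] for the span of the [A^z S] with [|z| <= a]; then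
    [E_a (E_b S) = E_(a+b) S], and each run of the extended Krylov method with
    starting block [C] produces a factor with columns in [E_d C].  If
    [A N - N A] has its range in [S'] and [N S] is contained in [S'], then
    [N (E_a S)] is contained in [E_a S'], because moving [N] across one more
    factor [A] or [A^-1] costs only a term in [S'] or [A^-1 S'].  Applied to
    the nested spaces [S_j = G_j(N; C) + G_(j-1)(N; U)], which satisfy
    [N_i S_j <= S_(j+1)] and contain [range U] as soon as [j >= 1], this gives
    [range L_j <= E_((j+1)d) S_j] by induction on [j].

    Subspaces of column vectors are represented as row spaces of transposed
    matrices, so that the calculus of [mxalgebra] applies. *)

Require Import Defs.
From mathcomp Require Import all_boot all_order all_algebra.
From mathcomp Require Import classical_sets reals.
From mathcomp Require Import monalg.

Set Implicit Arguments.
Unset Strict Implicit.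
Unset Printing Implicit Defensive.

Import Order.TTheory GRing.Theory Num.Theory.

Local Open Scope classical_set_scope.
Local Open Scope ring_scope.

(** * Linear spans and linearly closed sets of vectors *)

Definition lin_closed (R : realType) (E : lmodType R) (T : set E) : Prop :=
  T 0 /\ forall (c : R) (u v : E), T u -> T v -> T (c *: u + v).

Section LinearSpans.
Variables (R : realType) (E : lmodType R).
Implicit Types S T : set E.

Lemma lin_closedZ T (c : R) (u : E) : lin_closed T -> T u -> T (c *: u).
Proof. by case=> T0 TD Tu; rewrite -[c *: u]addr0; apply: TD. Qed.

Lemma lin_closedD T (u v : E) : lin_closed T -> T u -> T v -> T (u + v).
Proof. by case=> _ TD Tu Tv; rewrite -[u]scale1r; apply: TD. Qed.

Lemma lin_closed_sum T (I : Type) (r : seq I) (P : pred I) (f : I -> E) :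
  lin_closed T -> (forall i, P i -> T (f i)) -> T (\sum_(i <- r | P i) f i).
Proof.
move=> clT Tf; apply: (big_ind T) => //; first by case: clT.
by move=> u v; apply: lin_closedD.
Qed.

Lemma lspan_closed S : lin_closed (lspan S).
Proof.
split; first by exists 0%N, (fun=> 0), (fun=> 0); rewrite big_ord0; split=> // -[].
move=> c u v [k1 [c1 [x1 [S1 ->]]]] [k2 [c2 [x2 [S2 ->]]]].
exists (k1 + k2)%N,
  (fun i => match split i with inl j => c * c1 j | inr j => c2 j end),
  (fun i => match split i with inl j => x1 j | inr j => x2 j end).
split=> [i|]; first by case: (split i).
rewrite big_split_ord /= scaler_sumr; congr (_ + _); apply: eq_bigr => j _.
  by rewrite (unsplitK (inl j)) scalerA.
by rewrite (unsplitK (inr j)).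
Qed.

Lemma sub_lspan S : S `<=` lspan S.
Proof.
move=> v Sv; exists 1%N, (fun=> 1), (fun=> v); split=> //.
by rewrite big_ord1 scale1r.
Qed.

Lemma lspan_min S T : lin_closed T -> S `<=` T -> lspan S `<=` T.
Proof.
move=> clT ST v [k [c [x [Sx ->]]]].
by apply: lin_closed_sum => // i _; apply: lin_closedZ => //; apply/ST/Sx.
Qed.

Lemma addspace_closed S T :
  lin_closed S -> lin_closed T -> lin_closed (addspace S T).
Proof.
move=> [S0 SD] [T0 TD]; split; first by exists 0 => //; exists 0; rewrite ?addr0.
move=> c _ _ [u1 Su1 [v1 Tv1 <-]] [u2 Su2 [v2 Tv2 <-]].
exists (c *: u1 + u2); first exact: SD.
exists (c *: v1 + v2); first exact: TD.
by rewrite scalerDr addrACA.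
Qed.

Lemma addspacel S T : T 0 -> S `<=` addspace S T.
Proof. by move=> T0 v Sv; exists v => //; exists 0; rewrite ?addr0. Qed.

Lemma addspacer S T : S 0 -> T `<=` addspace S T.
Proof. by move=> S0 v Tv; exists 0 => //; exists v; rewrite ?add0r. Qed.

End LinearSpans.

(** Combined with [lspan_min], this carries a multiplication by [M] through a span: only the
    generators need checking. *)
Lemma mulmx_preim_closed (R : realType) (n p : nat) (M : 'M[R]_(n, p))
    (T : set 'cV[R]_n) :
  lin_closed T -> lin_closed [set v : 'cV[R]_p | T (M *m v)].
Proof.
move=> [T0 TD]; split=> [|c u v Tu Tv]; rewrite /= ?mulmx0 //.
by rewrite mulmxDr -scalemxAr; apply: TD.
Qed.

(** * Column spaces as row spaces of transposes *)

Lemma colspaceP (R : realType) (n p : nat) (M : 'M[R]_(n, p)) (v : 'cV[R]_n) :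
  colspace M v <-> (v^T <= M^T)%MS.
Proof.
split.
  move=> [k [c [x [xM ->]]]]; rewrite linear_sum summx_sub // => i _.
  rewrite linearZ scalemx_sub //; case: (xM i) => j _ <-.
  by rewrite /= tr_col row_sub.
case/submxP=> w /(congr1 trmx); rewrite trmx_mul !trmxK => ->.
have -> : M *m w^T = \sum_j w^T j 0 *: col j M.
  apply/colP=> i; rewrite !mxE summxE; apply: eq_bigr => j _.
  by rewrite !mxE mulrC.
apply: lin_closed_sum; first exact: lspan_closed.
move=> j _; apply: lin_closedZ; first exact: lspan_closed.
by apply: sub_lspan; exists j.
Qed.

Lemma colspace_subP (R : realType) (n p q : nat) (M : 'M[R]_(n, p))
    (M' : 'M[R]_(n, q)) :
  colspace M `<=` colspace M' -> (M^T <= M'^T)%MS.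
Proof.
move=> MM'; apply/row_subP => i; rewrite -tr_col.
by apply/colspaceP/MM'; apply: sub_lspan; exists i.
Qed.

Lemma is_orth_sub (R : realType) (n p q : nat) (M : 'M[R]_(n, p))
    (V : 'M[R]_(n, q)) :
  is_orth M V -> (V^T <= M^T)%MS.
Proof. by case=> _ VM; apply: colspace_subP; rewrite VM. Qed.

Lemma mxcol_subP (F : fieldType) (k n p : nat) (q : 'I_k -> nat)
    (B : forall i, 'M[F]_(q i, n)) (S : 'M[F]_(p, n)) :
  reflect (forall i, (B i <= S)%MS) (\mxcol_i B i <= S)%MS.
Proof.
rewrite eqmx_col; apply: (iffP sumsmx_subP) => sBS i; last by rewrite genmxE.
by move: (sBS i isT); rewrite genmxE.
Qed.

(** * Spaces generated by positive and negative powers of a matrix *)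

Section LaurentKrylov.
Variables (F : fieldType) (n : nat).
Implicit Types A N : 'M[F]_n.

(* Its row space is spanned by the rows of the [D *m A ^ z], [|z| <= a], when
   [A] is invertible. *)
Definition laurent p A (a : nat) (D : 'M[F]_(p, n)) : 'M[F]_n :=
  iter a (fun S => S + S *m A + S *m invmx A)%MS <<D>>%MS.

Lemma laurent_recE p A a (D : 'M[F]_(p, n)) :
  laurent A a.+1 D
  = (laurent A a D + laurent A a D *m A + laurent A a D *m invmx A)%MS.
Proof. by []. Qed.

Lemma laurent_stepS p q A (S : 'M[F]_(p, n)) (T : 'M[F]_(q, n)) :
  (S <= T)%MS ->
  (S + S *m A + S *m invmx A <= T + T *m A + T *m invmx A)%MS.
Proof. by move=> ST; rewrite !addsmxS ?submxMr. Qed.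

Lemma laurentS p q A a (D : 'M[F]_(p, n)) (D' : 'M[F]_(q, n)) :
  (D <= D')%MS -> (laurent A a D <= laurent A a D')%MS.
Proof.
move=> DD'; elim: a => [|a IH]; first by rewrite /= !genmxE.
exact: laurent_stepS.
Qed.

Lemma laurent_le p A a b (D : 'M[F]_(p, n)) :
  (a <= b)%N -> (laurent A a D <= laurent A b D)%MS.
Proof.
move=> /subnK <-; elim: (b - a)%N => // c /submx_trans; apply.
by rewrite addSn /= -addsmxA addsmxSl.
Qed.

Lemma laurent_add p A a b (D : 'M[F]_(p, n)) :
  (laurent A a (laurent A b D) <= laurent A (a + b) D)%MS.
Proof.
elim: a => [|a IH]; first by rewrite /= genmxE.
by rewrite addSn; apply: laurent_stepS.
Qed.

Lemma laurent_base p A a (D : 'M[F]_(p, n)) : (D <= laurent A a D)%MS.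
Proof. by apply: submx_trans (laurent_le A D (leq0n a)); rewrite genmxE. Qed.

Lemma laurent_mulr p A a (D : 'M[F]_(p, n)) :
  (laurent A a D *m A <= laurent A a.+1 D)%MS.
Proof. exact: submx_trans (addsmxSr _ _) (addsmxSl _ _). Qed.

Lemma laurent_mulVr p A a (D : 'M[F]_(p, n)) :
  (laurent A a D *m invmx A <= laurent A a.+1 D)%MS.
Proof. exact: addsmxSr. Qed.

(** The level [a] does not grow: the correction for a factor [A] lies in [D'] itself, the one for
    [invmx A] in [D' *m invmx A], and both are already present at level 1. *)
Lemma laurent_commutator p q A N a (D : 'M[F]_(p, n)) (D' : 'M[F]_(q, n)) :
  A \in unitmx -> (A *m N - N *m A <= D')%MS -> (D *m N <= D')%MS ->
  (laurent A a D *m N <= laurent A a D')%MS.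
Proof.
move=> uA sUD sND; elim: a => [|a IH].
  by rewrite /= genmxE (eqmxMr _ (genmxE _)).
rewrite [laurent A _ D]/= !(addsmxMr, addsmx_sub) -andbA; apply/and3P; split.
- exact: submx_trans IH (laurent_le _ _ (leqnSn a)).
- have -> : laurent A a D *m A *m N = laurent A a D *m N *m A
              + laurent A a D *m (A *m N - N *m A).
    by rewrite mulmxBr !mulmxA addrC subrK.
  apply: addmx_sub; first exact: submx_trans (submxMr _ IH) (laurent_mulr _ _ _).
  apply: submx_trans (submxMl _ _) _.
  exact: submx_trans sUD (laurent_base _ _ _).
(* The commutator with the inverse comes from the given one: [[A^-1, N] = - A^-1 [A, N] A^-1]. *)
- have -> : laurent A a D *m invmx A *m N = laurent A a D *m N *m invmx A
              - laurent A a D *m invmx A *m (A *m N - N *m A) *m invmx A.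
    rewrite mulmxBr mulmxBl !mulmxA (mulmxKV uA).
    by rewrite -[X in _ - (_ - X)]mulmxA (mulmxV uA) mulmx1 opprB addrC subrK.
  rewrite -[_ - _]addrC; apply: addmx_sub; last first.
    exact: submx_trans (submxMr _ IH) (laurent_mulVr _ _ _).
  rewrite eqmx_opp; apply: submx_trans (laurent_mulVr _ _ _).
  apply/submxMr/(submx_trans (submxMl _ _)).
  exact: submx_trans sUD (laurent_base _ _ _).
Qed.

End LaurentKrylov.

(** * Extended Krylov spaces and the output of the extended Krylov method *)

Section ExtendedKrylov.
Variables (R : realType) (n r : nat).
Implicit Types (A : 'M[R]_n.+1) (C : 'M[R]_(n.+1, r)) (v : 'cV[R]_n.+1).

Lemma ext_krylov_closed k A C : lin_closed (ext_krylov k A C).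
Proof. by apply: addspace_closed; apply: lspan_closed. Qed.

(** Each level multiplies by [A ^ z0] with [z0] equal to 0, 1 or -1; since [A] is invertible,
    exponents add and [absz] grows by at most one. *)
Lemma laurent_monomials a A C v :
  A \in unitmx -> (v^T <= laurent A^T a C^T)%MS ->
  lspan [set u | exists (z : int) (w : 'cV[R]_r),
           (absz z <= a)%N /\ u = A ^ z *m C *m w] v.
Proof.
move=> uA; elim: a v => [|a IH] v.
  rewrite /= genmxE => /submxP [w /(congr1 trmx)].
  rewrite trmx_mul !trmxK => ->; apply: sub_lspan.
  by exists 0, w^T; rewrite expr0z mul1mx.
have clT := @lspan_closed R 'cV[R]_n.+1.
have shift z0 u : (absz z0 <= 1)%N -> (u^T <= laurent A^T a C^T)%MS ->
    lspan [set u | exists (z : int) (w : 'cV[R]_r),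
      (absz z <= a.+1)%N /\ u = A ^ z *m C *m w] (A ^ z0 *m u).
  move=> z01 /IH; move: u; apply: lspan_min.
    exact: mulmx_preim_closed.
  move=> _ [z [w [za ->]]]; apply: sub_lspan; exists (z0 + z), w; split.
    rewrite -lez_nat abszE (le_trans (ler_normD _ _)) // -!abszE.
    by rewrite -PoszD lez_nat (leq_add z01 za).
  by rewrite exprzDr // !mulmxA.
have sE (w : 'rV[R]_n.+1) :
    (((w *m laurent A^T a C^T)^T)^T <= laurent A^T a C^T)%MS.
  by rewrite trmxK submxMl.
rewrite laurent_recE; set S := laurent A^T a C^T in sE shift *.
move=> /sub_addsmxP [[u1 u2] /= /(congr1 trmx)].
have [[w1 w2] /= ->] := sub_addsmxP (submxMl u1 (S + S *m A^T)%MS).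
rewrite trmxK => ->; rewrite !mulmxA -trmx_inv !linearD /=.
rewrite ![(_ *m _^T)^T]trmx_mul !trmxK.
apply: lin_closedD => //; first apply: lin_closedD => //.
- by have := shift 0 _ isT (sE w1); rewrite expr0z mul1mx.
- by have := shift 1 _ isT (sE w2); rewrite expr1z.
- by have := shift (-1) _ isT (sE u2).
Qed.

Lemma laurent_ext_krylov a A C v :
  A \in unitmx -> (v^T <= laurent A^T a C^T)%MS -> ext_krylov a A C v.
Proof.
move=> uA /(laurent_monomials uA); move: v; apply: lspan_min.
  exact: ext_krylov_closed.
have lspan0 := fun S => proj1 (@lspan_closed R 'cV[R]_n.+1 S).
move=> _ [[k|k] [w [ka ->]]].
- apply: (addspacel (lspan0 _)); apply: sub_lspan; exists 'X^k, w.
  by rewrite size_polyXn rmorphXn /= horner_mx_X.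
(* [Negz k] is [-(k+1)]: one inverse factor is absorbed by the block [invmx A *m C], which leaves
   degree [k]. *)
- apply: (addspacer (lspan0 _)); apply: sub_lspan; exists 'X^k, w.
  rewrite size_polyXn rmorphXn /= horner_mx_X ltnS (ltnW ka); split=> //.
  by rewrite NegzE -exprz_inv -exprnP exprSr !mulmxA.
Qed.

(** A new block is spanned by [A] or [invmx A] times parts of the previous block, minus a
    combination of earlier blocks, so each step raises the level by at most one. *)
Lemma eks_basis A C (V : nat -> 'M[R]_(n.+1, r + r)) (K : nat) :
  eks_start A C (V 1%N) -> (forall k, (1 <= k < K)%N -> eks_step A V k) ->
  ((basis V K)^T <= laurent A^T K C^T)%MS.
Proof.
move=> start step.
suff V_le k : (k < K)%N -> ((V k.+1)^T <= laurent A^T k.+1 C^T)%MS.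
  rewrite /basis tr_mxrow; apply/mxcol_subP => j.
  exact: submx_trans (V_le j (ltn_ord j)) (laurent_le _ _ (ltn_ord j)).
(* Strong induction, because the orthogonalization involves all earlier blocks and not only the last
   one. *)
elim/ltn_ind: k => -[_ _|k IH kK].
  apply: submx_trans (is_orth_sub start) _.
  have CE := laurent_base A^T 0 C^T.
  rewrite tr_row_mx col_mx_sub (submx_trans CE (laurent_le _ _ _)) //=.
  rewrite trmx_mul trmx_inv.
  exact: submx_trans (submxMr _ CE) (laurent_mulVr _ _ _).
apply: submx_trans (is_orth_sub (step k.+1 kK)) _.
have sub_Vk : ((V k.+1)^T <= laurent A^T k.+1 C^T)%MS.
  by apply: IH => //; apply: ltnW.
have lVk : ((lsubmx (V k.+1))^T <= laurent A^T k.+1 C^T)%MS.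
  rewrite trmx_lsub (submx_trans _ sub_Vk) //.
  by rewrite -{2}[(V k.+1)^T]vsubmxK -addsmxE addsmxSl.
have rVk : ((rsubmx (V k.+1))^T <= laurent A^T k.+1 C^T)%MS.
  rewrite trmx_rsub (submx_trans _ sub_Vk) //.
  by rewrite -{2}[(V k.+1)^T]vsubmxK -addsmxE addsmxSr.
have basis_le : ((basis V k.+1)^T <= laurent A^T k.+2 C^T)%MS.
  rewrite /basis tr_mxrow; apply/mxcol_subP => -[j jk] /=.
  exact: submx_trans (IH _ jk (ltn_trans jk kK)) (laurent_le _ _ (leqW jk)).
rewrite linearB /=; apply: addmx_sub; last first.
  by rewrite eqmx_opp trmx_mul (submx_trans (submxMl _ _)).
rewrite tr_row_mx col_mx_sub !trmx_mul trmx_inv; apply/andP; split.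
  exact: submx_trans (submxMr _ lVk) (laurent_mulr _ _ _).
exact: submx_trans (submxMr _ rVk) (laurent_mulVr _ _ _).
Qed.

Lemma eks_result_laurent A B F C1 C2 (d : nat) (tol : R) (q : nat)
    (L P : 'M[R]_(n.+1, q)) :
  eks_result A B F C1 C2 d tol L P ->
  (L^T <= laurent A^T d C1^T)%MS /\ (P^T <= laurent B^T d C2^T)%MS.
Proof.
case=> K [V [W [Z [Lh [Rh]]]]] [/andP[_ Kd]] [sV] [sW] [_] [step] [_] [_] [-> ->].
rewrite !trmx_mul; split; apply: submx_trans (submxMl _ _) _.
  apply: submx_trans (eks_basis sV _) (laurent_le _ _ Kd).
  by move=> k /step [].
apply: submx_trans (eks_basis sW _) (laurent_le _ _ Kd).
by move=> k /step [].
Qed.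

End ExtendedKrylov.

(** * Multivariate Krylov spaces *)

Section MultivariateKrylov.
Variables (F : fieldType) (n m : nat) (N : 'I_m -> 'M[F]_n).

(* The index is shifted: [mvspace d U] stands for [G_(d-1)(N; U)]. *)
Definition mvspace p (d : nat) (U : 'M[F]_(p, n)) : 'M[F]_n :=
  iter d (fun S => <<U>> + \sum_i S *m N i)%MS 0.

Lemma mvspaceS p d (U : 'M[F]_(p, n)) : (mvspace d U <= mvspace d.+1 U)%MS.
Proof.
elim: d => [|d IH]; first exact: sub0mx.
rewrite addsmxS //; apply/sumsmx_subP => i _.
by rewrite (sumsmx_sup i) // submxMr.
Qed.

Lemma mvspace_base p d (U : 'M[F]_(p, n)) : (U <= mvspace d.+1 U)%MS.
Proof. by rewrite -(genmxE U) addsmxSl. Qed.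

Lemma mvspace_mulr p d (U : 'M[F]_(p, n)) i :
  (mvspace d U *m N i <= mvspace d.+1 U)%MS.
Proof. by apply: submx_trans (addsmxSr _ _); rewrite (sumsmx_sup i). Qed.

End MultivariateKrylov.

(** Unfolding the recursion yields words of length below [d]: the base [U] is the empty word, and a
    further factor [N i] prepends the letter [i], since transposition turns right factors into left
    ones. *)
Lemma mvspace_mv_krylov (R : realType) (n r m d : nat)
    (N : 'I_m -> 'M[R]_n.+1) (U : 'M[R]_(n.+1, r)) (v : 'cV[R]_n.+1) :
  (v^T <= mvspace (fun i => (N i)^T) d U^T)%MS -> mv_krylov (d%:Z - 1) N U v.
Proof.
suff words : (v^T <= mvspace (fun i => (N i)^T) d U^T)%MS ->
    lspan [set u | exists (w : seq 'I_m) (z : 'cV[R]_r),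
      (size w < d)%N /\ u = (\prod_(i <- w) N i) *m U *m z] v.
  move/words; move: v {words}; apply: lspan_min; first exact: lspan_closed.
  move=> _ [w [z [wd ->]]]; apply: sub_lspan.
  (* The measure of a monomial is its length plus one, so [size w < d] is the required bound. *)
  exists << FMonom w >>, z; rewrite subrK lez_nat mmeasureE msuppU1.
  rewrite finmap.big_seq_fset1; split; first exact: wd.
  by rewrite /nc_eval (mmapU (f := @scalar_mx R n.+1)) mul1r.
elim: d v => [|d IH] v.
  rewrite submx0 -trmx0 => /eqP/trmx_inj ->.
  exact: proj1 (lspan_closed _).
case/sub_addsmxP => -[u1 u2] /= /(congr1 trmx).
have [w ->] := sub_sumsmxP (submxMl u2
  (\sum_i (mvspace (fun i => (N i)^T) d U^T *m (N i)^T))%MS).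
have /submxP [u0 ->] : (u1 *m <<U^T>>%MS <= U^T)%MS.
  by rewrite -(genmxE U^T) submxMl.
rewrite trmxK linearD linear_sum /= trmx_mul trmxK => ->.
have clT := @lspan_closed R 'cV[R]_n.+1.
apply: lin_closedD => //.
  by apply: sub_lspan; exists [::], u0^T; rewrite big_nil mul1mx.
apply: lin_closed_sum => // i _.
rewrite mulmxA trmx_mul trmxK.
have /IH : ((w i *m mvspace (fun i => (N i)^T) d U^T)^T^T <=
  mvspace (fun i => (N i)^T) d U^T)%MS by rewrite trmxK submxMl.
move: (_^T); apply: lspan_min; first exact: mulmx_preim_closed.
move=> _ [x [z [xd ->]]]; apply: sub_lspan; exists (i :: x), z.
by rewrite big_cons !mulmxA.
Qed.

(** * Propagation of one family of factors along the Neumann recursion *)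

Section OneSidedFactors.
Variables (F : fieldType) (n r s m : nat).
Variables (A : 'M[F]_n) (N : 'I_m -> 'M[F]_n).
Variables (C : 'M[F]_(r, n)) (U : 'M[F]_(s, n)).

(** Because of the index shift in [mvspace], this is [G_j(N; C) + G_(j-1)(N; U)] in row form. *)
Definition starting_space (j : nat) : 'M[F]_n :=
  (mvspace N j.+1 C + mvspace N j U)%MS.

Lemma starting_spaceS j : (starting_space j <= starting_space j.+1)%MS.
Proof. by rewrite addsmxS ?mvspaceS. Qed.

Lemma starting_space_le j k :
  (j <= k)%N -> (starting_space j <= starting_space k)%MS.
Proof.
move=> /subnK <-; elim: (k - j)%N => // i /submx_trans; apply.
exact: starting_spaceS.
Qed.

Lemma starting_space_mulr j i :
  (starting_space j *m N i <= starting_space j.+1)%MS.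
Proof. by rewrite addsmxMr addsmxS ?mvspace_mulr. Qed.

Lemma factors_laurent (d l : nat) (q : nat -> nat)
    (L : forall j, 'M[F]_(q j, n)) :
  A \in unitmx -> (forall i, (A *m N i - N i *m A <= U)%MS) ->
  (L 0%N <= laurent A d C)%MS ->
  (forall j, (j < l)%N ->
     (L j.+1 <= laurent A d (\mxcol_(i < m) (L j *m N i)))%MS) ->
  forall j, (j <= l)%N ->
    (L j <= laurent A (j.+1 * d) (starting_space j))%MS.
Proof.
move=> uA sU L0 LS; elim=> [|j IH] jl.
  rewrite mul1n (submx_trans L0) // laurentS //.
  by apply: submx_trans (addsmxSl _ _); apply: mvspace_base.
apply: submx_trans (LS j jl) _.
(* The level [(j+2)d] splits into [d] for the new run and [(j+1)d] inherited from [L j]. *)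
rewrite mulSn; apply: submx_trans (laurent_add _ _ _ _); apply: laurentS.
apply/mxcol_subP => i; apply: submx_trans (submxMr _ (IH (ltnW jl))) _.
apply: laurent_commutator (starting_space_mulr _ _) => //.
(* The target has index [j.+1], so its second summand [mvspace N j.+1 U] contains [U]; at index 0
   that summand is zero. *)
apply: submx_trans (sU i) _.
by apply: submx_trans (addsmxSr _ _); apply: mvspace_base.
Qed.

End OneSidedFactors.

(** One-sided form of the theorem, to be used once for [A], [N] and once for [B], [M]. The witness
    is the transpose of the last starting space, which contains all earlier ones. *)
Lemma factors_krylov (R : realType) (n r m d l : nat)
    (A : 'M[R]_n.+1) (N : 'I_m -> 'M[R]_n.+1) (C : 'M[R]_(n.+1, r))
    (s : 'I_m -> nat) (U Ut : forall i : 'I_m, 'M[R]_(n.+1, s i))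
    (q : nat -> nat) (L : forall j : nat, 'M[R]_(n.+1, q j)) :
  A \in unitmx ->
  (forall i, commutator A (N i) = U i *m (Ut i)^T) ->
  ((L 0%N)^T <= laurent A^T d C^T)%MS ->
  (forall j, (j < l)%N ->
     ((L j.+1)^T <= laurent A^T d (\mxrow_(i < m) (N i *m L j))^T)%MS) ->
  exists Ch : 'M[R]_(n.+1, n.+1),
    colspace (\mxrow_(j < l.+1) L j) `<=` ext_krylov (l.+1 * d) A Ch /\
    colspace Ch `<=` addspace (mv_krylov l%:Z N C)
                              (mv_krylov (l%:Z - 1) N (\mxrow_i U i)).
Proof.
move=> uA hU L0 LS.
set W := starting_space (fun i => (N i)^T) C^T (\mxrow_i U i)^T l.
exists W^T; split=> v /colspaceP.
  move=> vL; apply: laurent_ext_krylov => //; rewrite trmxK.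
  apply: submx_trans vL _; rewrite tr_mxrow; apply/mxcol_subP => j.
  have jl : (j <= l)%N by rewrite -ltnS.
  apply: (@submx_trans _ _ _ _ _ _ (laurent A^T (j.+1 * d) W)); last first.
    by apply: laurent_le; rewrite leq_mul2r ltnS jl orbT.
  apply: submx_trans (laurentS _ _ (starting_space_le _ _ _ jl)).
  apply: (@factors_laurent _ _ _ _ _ _ _ _ _ d l _ (fun j => (L j)^T)) => //.
  - by rewrite unitmx_tr.
  - move=> i; rewrite tr_mxrow.
    (* Transposition reverses the products and flips the sign of the commutator; its row space still
       lies in that of [(U i)^T]. *)
    have -> : A^T *m (N i)^T - (N i)^T *m A^T = - (Ut i *m (U i)^T).
      have := congr1 trmx (hU i).
      by rewrite linearB /= !trmx_mul trmxK => <-; rewrite opprB.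
    rewrite eqmx_opp (submx_trans (submxMl _ _)) //.
    exact: (mxcol_subP _ _ (submx_refl _)).
  - move=> k kl; apply: submx_trans (LS k kl) _; apply: laurentS.
    rewrite tr_mxrow; apply/mxcol_subP => i; rewrite trmx_mul.
    exact: (mxcol_subP (fun i => (L k)^T *m (N i)^T) _ (submx_refl _)).
rewrite trmxK => /sub_addsmxP [[u1 u2] /= /(congr1 trmx)].
rewrite trmxK linearD /= => ->.
exists ((u1 *m mvspace (fun i => (N i)^T) l.+1 C^T)^T).
  (* Matches the shifted index: [mvspace] at [l.+1] stands for [G_l]. *)
  have -> : l%:Z = l.+1%:Z - 1 by rewrite -addn1 PoszD addrK.
  by apply: mvspace_mv_krylov; rewrite trmxK submxMl.
eexists; last by [].
by apply: mvspace_mv_krylov; rewrite trmxK submxMl.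
Qed.

(** * Assembly of the two sides *)

Theorem theorem3p7 (R : realType) (n r m : nat)
    (A B : 'M[R]_n.+1) (N M : 'I_m -> 'M[R]_n.+1) (C1 C2 : 'M[R]_(n.+1, r))
    (hA : A \in unitmx) (hB : B \in unitmx)
    (s t : 'I_m -> nat)
    (U Ut : forall i : 'I_m, 'M[R]_(n.+1, s i))
    (Q Qt : forall i : 'I_m, 'M[R]_(n.+1, t i))
    (hU : forall i : 'I_m, commutator A (N i) = U i *m (Ut i)^T)
    (hQ : forall i : 'I_m, commutator B (M i) = Q i *m (Qt i)^T)
    (d : nat) (hd : (1 <= d)%N) (l : nat) (tol : nat -> R)
    (q : nat -> nat) (Lf Rf : forall j : nat, 'M[R]_(n.+1, q j))
    (h0 : eks_result A B (C1 *m C2^T) C1 C2 d (tol 0%N) (Lf 0%N) (Rf 0%N))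
    (hS : forall j : nat, (j < l)%N ->
       eks_result A B
         (- \sum_(i < m) (N i *m Lf j) *m (M i *m Rf j)^T)
         (\mxrow_(i < m) (N i *m Lf j)) (\mxrow_(i < m) (M i *m Rf j))
         d (tol j.+1) (Lf j.+1) (Rf j.+1)) :
  let Y := fun j : nat => Lf j *m (Rf j)^T in
  let X := \sum_(0 <= j < l.+1) Y j in
  exists (p p1 p2 : nat) (L R' : 'M[R]_(n.+1, p))
    (Ch1 : 'M[R]_(n.+1, p1)) (Ch2 : 'M[R]_(n.+1, p2)),
    [/\ X = L *m R'^T,
        colspace L `<=` ext_krylov (l.+1 * d) A Ch1
          /\ colspace R' `<=` ext_krylov (l.+1 * d) B Ch2,
        colspace Ch1 `<=` addspace (mv_krylov l%:Z N C1)
                                   (mv_krylov (l%:Z - 1) N (\mxrow_i U i))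
      & colspace Ch2 `<=` addspace (mv_krylov l%:Z M C2)
                                   (mv_krylov (l%:Z - 1) M (\mxrow_i Q i))].
Proof.
move=> Y X.
have LR0 := eks_result_laurent h0.
have LRS j jl := eks_result_laurent (hS j jl).
have [Ch1 [L1 S1]] := factors_krylov hA hU LR0.1 (fun j jl => (LRS j jl).1).
have [Ch2 [L2 S2]] := factors_krylov hB hQ LR0.2 (fun j jl => (LRS j jl).2).
(* Placing all factors side by side turns the sum of the [Lf j *m (Rf j)^T] into a single block
   product. *)
exists _, _, _, (\mxrow_(j < l.+1) Lf j), (\mxrow_(j < l.+1) Rf j), Ch1, Ch2.
by split=> //; rewrite tr_mxrow mul_mxrow_mxcol /X big_mkord.
Qed.
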